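(* Let $G=(V,E,\omega)$ be an infinite weighted graph as in the context, and let $p>1$, $q>0$. Assume $r\ge1$ and $q(p-1)\ge r$. Let $u,v\in L^\infty([0,T);\ell^r(V))$ be two solutions of the Leibenson equation $\partial_t u=\Delta_p u^q$ on $V\times(0,T)$ (with their respective initial values). If $u(x,0)\le v(x,0)$ for every $x\in V$, then $u(x,t)\le v(x,t)$ for every $x\in V$ and $0\le t<T$. In particular, for $u_0\in\ell^r(V)$, the solution in $L^\infty([0,T);\ell^r(V))$ with initial value $u_0$ is unique.
   Context: Graph: $G=(V,E,\omega)$ is an infinite, connected, countable weighted graph with no multiple edges or self-loops; $\omega:V\times V\to[0,\infty)$ is symmetric and $\omega_{xy}=\omega(x,y)>0$ if and only if $\{x,y\}\in E$ (written $x\sim y$). Every vertex has finite degree, $\mu(x)=\sum_{y\sim x}\omega_{xy}$, and $\mu_0:=\inf_{x\in V}\mu(x)>0$. Norms: $\|f\|_{\ell^r(V)}=\big(\sum_{x\in V}|f(x)|^r\mu(x)\big)^{1/r}$ for $r\ge1$. Powers: for $k\in\mathbb R$, $s>0$, $k^s:=|k|^{s-1}k$ (so $0^s=0$). Operator: $\Delta_p u^q(x,t)=\frac1{\mu(x)}\sum_{y\in V}|u^q(y,t)-u^q(x,t)|^{p-2}(u^q(y,t)-u^q(x,t))\,\omega_{xy}$. Solution: a solution in $L^\infty([0,T);\ell^r(V))$ ($0<T\le+\infty$, $r\ge1$) with initial value $u_0$ is a function $u:V\times[0,T)\to\mathbb R$ with $u\in L^\infty([0,T);\ell^r(V))$,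 $u(x,\cdot)\in C^1([0,T))$ for all $x\in V$, satisfying pointwise $\partial_t u(x,t)=\Delta_p u^q(x,t)$ for $x\in V$, $0<t<T$, and $u(x,0)=u_0(x)$ for $x\in V$. *)

(* Defs.v *)
From HB Require Import structures.
From mathcomp Require Import all_boot all_order all_algebra.
From mathcomp Require Import all_classical all_reals all_analysis.
From mathcomp Require Import ess_sup_inf.

Set Implicit Arguments.
Unset Strict Implicit.
Unset Printing Implicit Defensive.

Import Order.TTheory GRing.Theory Num.Theory.
Import numFieldNormedType.Exports.

Local Open Scope classical_set_scope.
Local Open Scope ring_scope.

Definition adjacent (R : realType) (V : Type) (w : V -> V -> R) : rel V :=
  fun x y => 0 < w x y.

Definition degree_measure (R : realType) (V : choiceType) (w : V -> V -> R)
    (x : V) : R :=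
  \sum_(y \in [set y | adjacent w x y]) w x y.

(* The edge set is the support of the weight, so multiple edges are excluded
   by the representation. *)
Record weighted_graph (R : realType) := WeightedGraph {
  vertex :> countType;
  weight : vertex -> vertex -> R;
  weight_ge0 : forall x y, 0 <= weight x y;
  weight_sym : forall x y, weight x y = weight y x;
  no_loops : forall x, ~~ adjacent weight x x;
  vertex_infinite : infinite_set [set: vertex];
  locally_finite : forall x, finite_set [set y | adjacent weight x y];
  graph_connected : forall x y,
    exists2 s : seq vertex, path (adjacent weight) x s & last x s = y;
  degree_measure_inf_gt0 : 0 < inf (range (degree_measure weight))
}.

Definition mu (R : realType) (G : weighted_graph R) (x : G) : R :=
  degree_measure (@weight R G) x.

Definition lr_norm (R : realType) (G : weighted_graph R) (r : R) (f : G -> R)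
    : \bar R :=
  ((\esum_(x in [set: G]) (`|f x| `^ r * mu x)%:E) `^ r^-1)%E.

Definition in_lr (R : realType) (G : weighted_graph R) (r : R) (f : G -> R)
    : Prop :=
  (lr_norm r f < +oo)%E.

(* k^s = |k|^(s-1) k *)
Definition signed_pow (R : realType) (k s : R) : R := `|k| `^ (s - 1) * k.

(* The sum over all vertices is a finite sum: [\sum_(y \in A)] runs over the
   support of the summand, which consists of neighbours of [x]. *)
Definition p_laplacian (R : realType) (G : weighted_graph R) (p : R)
    (f : G -> R) (x : G) : R :=
  (mu x)^-1 *
  \sum_(y \in [set: G]) `|f y - f x| `^ (p - 2) * (f y - f x) * weight x y.

Definition time_interval (R : realType) (T : \bar R) : set R :=
  [set t | 0 <= t /\ (t%:E < T)%E].

(* C^1 relative to [I]; the derivative is one-sided at an endpoint in [I]. *)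
Definition C1_on (R : realType) (I : set R) (f : R -> R) : Prop :=
  exists2 g : R -> R, {within I, continuous g} &
    forall t, I t -> (f s - f t) / (s - t) @[s --> within I t^'] --> g t.

(* [f \_ I] extends [f] by 0 outside [I]. Strong measurability of
   t |-> u(., t) is not listed: it is automatic when, as in [is_solution],
   every u(x, .) is continuous, since l^r(V) is separable. *)
Definition in_Linfty_lr (R : realType) (G : weighted_graph R) (T : \bar R)
    (r : R) (u : G -> R -> R) : Prop :=
  (ess_sup lebesgue_measure
     ((fun t => lr_norm r (u ^~ t)) \_ (time_interval T)) < +oo)%E.

(* Functions on V x [0, T) are total in time; their values outside [0, T)
   play no role. *)
Record is_solution (R : realType) (G : weighted_graph R) (p q r : R)
    (T : \bar R) (u0 : G -> R) (u : G -> R -> R) : Prop := IsSolution {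
  solution_Linfty : in_Linfty_lr T r u;
  solution_C1 : forall x, C1_on (time_interval T) (u x);
  solution_eq : forall (x : G) (t : R), 0 < t -> (t%:E < T)%E ->
    (u x)^`()%classic t = p_laplacian p (fun y => signed_pow (u y t) q) x;
  solution_init : forall x, u x 0 = u0 x
}.

(* Main.v *)
Require Import Defs.
From mathcomp Require Import all_boot all_order all_algebra finmap.
From mathcomp Require Import all_classical all_reals all_analysis.
From mathcomp Require Import ess_sup_inf ring lra.

(** The comparison principle is an l^1 accretivity argument run against a
slowly varying cutoff.  Write [w = u - v], and let [F s = |s|^(p-2) s], which is
increasing and odd, so that the difference of the two equations at [x] reads
[mu x * w' x = \sum_y (F (u^q y - u^q x) - F (v^q y - v^q x)) * weight x y].
Multiply by the indicator of [w x > 0] and by a finitely supported cutoff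
[phi >= 0], and sum over [x].  The flux is antisymmetric in [(x, y)], so the
double sum symmetrizes.  An edge between a vertex where [u > v] and one where
[u <= v] contributes with a favourable sign, by monotonicity of [F]; an edge
inside [u > v] contributes at most [|phi x - phi y|] times the size of the flux.
If [phi] is 1-Lipschitz along edges, the total is therefore at most the sum of
all fluxes ([cutoff_flux_le]).

That sum is bounded uniformly in time.  It is controlled by
[\sum_x |u x|^(q (p-1)) * mu x], and since [mu] is bounded below a bound in l^r
is also a pointwise bound, hence a bound in l^(q (p-1)) because
[q (p-1) >= r] ([solution_flux_sum_le]).  The essential bound on the l^r norm
holds at every interior time, since each finite partial sum is continuous in
time ([Linfty_lr_sum_le]).

So [f = \sum_x phi x * mu x * max 0 (w x)] starts at 0 and grows at rate at most
a constant [C] that does not depend on [phi].  Taking for [phi] the tent of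
height [N] at a vertex [o] gives [N * mu o * max 0 (w o t) <= C * t] for every
[N], whence [w o t <= 0].  The gradient bound of the tent makes the boundary
contributions uniformly bounded in time, while its height is unbounded; the
indicators of an exhaustion would only give boundary terms that tend to 0 at
each time separately.

The positive part is not differentiable, so growth is measured by the upper
right slope ([right_slope_le]).  Where [w x = 0], the slope of [max 0 (w x)] is
[w' x] or 0 according to the sign of [w' x], so the indicator above may take
either value there; both are admissible in the symmetrization. *)

Import Order.TTheory GRing.Theory Num.Theory.
Import numFieldNormedType.Exports.

Local Open Scope classical_set_scope.
Local Open Scope ring_scope.

Set Implicit Arguments.
Unset Strict Implicit.
Unset Printing Implicit Defensive.

(** * Signed powers *)

Lemma signed_powN (R : realType) (k s : R) :
  signed_pow (- k) s = - signed_pow k s.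
Proof. by rewrite /signed_pow normrN mulrN. Qed.

Lemma ge0_signed_pow (R : realType) (k s : R) :
  0 < s -> 0 <= k -> signed_pow k s = k `^ s.
Proof. by move=> s0 k0; rewrite /signed_pow ger0_norm// mulrC mulr_powRB1. Qed.

Lemma normr_signed_pow (R : realType) (k s : R) :
  0 < s -> `|signed_pow k s| = `|k| `^ s.
Proof.
move=> s0; rewrite /signed_pow normrM (ger0_norm (powR_ge0 _ _)) mulrC.
by rewrite mulr_powRB1.
Qed.

(** This monotonicity gives the flux across an edge its sign, and lets the order
of [u] and [v] pass to [u^q] and [v^q]. *)
Lemma signed_pow_le (R : realType) (s k l : R) :
  0 < s -> k <= l -> signed_pow k s <= signed_pow l s.
Proof.
move=> s0; have nneg a b : 0 <= a -> a <= b -> signed_pow a s <= signed_pow b s.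
  move=> a0 ab; have b0 := le_trans a0 ab.
  by rewrite !ge0_signed_pow// ge0_ler_powR ?nnegrE// ltW.
have ge0 a : 0 <= a -> 0 <= signed_pow a s.
  by move=> a0; rewrite ge0_signed_pow// powR_ge0.
move=> kl; have [k0|k0] := leP 0 k; first exact: nneg.
have [l0|l0] := leP 0 l.
  apply: (@le_trans _ _ 0); last exact: ge0.
  by rewrite -oppr_ge0 -signed_powN ge0// oppr_ge0 ltW.
by rewrite -lerN2 -!signed_powN nneg ?oppr_ge0 ?lerN2// ltW.
Qed.

Lemma normr_subr_powR_le (R : realType) (s a b : R) : 0 <= s ->
  `|a - b| `^ s <= 2 `^ s * (`|a| `^ s + `|b| `^ s).
Proof.
move=> s0; have ab : `|a - b| <= 2 * Num.max `|a| `|b|.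
  rewrite (le_trans (ler_normB _ _))//.
  by have [ab|ba] := leP `|a| `|b|; lra.
have m0 : 0 <= Num.max `|a| `|b| by rewrite le_max normr_ge0.
apply: (@le_trans _ _ ((2 * Num.max `|a| `|b|) `^ s)).
  by rewrite ge0_ler_powR ?nnegrE// mulr_ge0.
rewrite powRM// ler_wpM2l ?powR_ge0//.
have [_|_] := leP `|a| `|b|; first by rewrite lerDr powR_ge0.
by rewrite lerDl powR_ge0.
Qed.

(** The elementary reason why bounded families in l^r are bounded in l^s for
[r <= s]: the surplus exponent is absorbed by the pointwise bound. *)
Lemma bounded_powR_le (R : realType) (r s k L : R) :
  0 < r -> r <= s -> `|k| `^ r <= L ->
  `|k| `^ s <= L `^ (s / r - 1) * `|k| `^ r.
Proof.
move=> r0 rs kL; have sr : 0 <= s / r - 1 by rewrite subr_ge0 ler_pdivlMr// mul1r.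
have -> : s = r * (s / r) by rewrite mulrCA mulfV ?mulr1// gt_eqF.
rewrite powRrM mulrAC mulfV ?gt_eqF// mul1r.
rewrite -[X in _ `^ X <= _](subrK 1 (s / r)).
rewrite -(mulr_powRB1 (powR_ge0 _ _)) ?ltr_wpDl// addrK mulrC.
rewrite ler_wpM2r ?powR_ge0// ge0_ler_powR ?nnegrE ?powR_ge0//.
exact: le_trans (powR_ge0 _ _) kL.
Qed.

(** * Growth of functions with a bounded upper right slope *)

(** The upper right Dini derivative of [f] at [s] is at most [D].  The form with
an arbitrary [e] is additive and avoids limits superior. *)
Definition right_slope_le (R : realType) (f : R -> R) (s D : R) : Prop :=
  forall e : R, 0 < e -> \forall s' \near s^'+, f s' <= f s + (D + e) * (s' - s).

Lemma right_slope_le_weaken (R : realType) (f : R -> R) (s D E : R) :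
  D <= E -> right_slope_le f s D -> right_slope_le f s E.
Proof.
move=> DE fD e e0; near=> t.
have st : s < t by near: t; exact: nbhs_right_gt.
apply: (@le_trans _ _ (f s + (D + e) * (t - s))); first by near: t; exact: fD.
by rewrite lerD2l ler_wpM2r ?subr_ge0 ?lerD2r// ltW.
Unshelve. all: by end_near. Qed.

Lemma right_slope_leD (R : realType) (f g : R -> R) (s D E : R) :
  right_slope_le f s D -> right_slope_le g s E ->
  right_slope_le (fun t => f t + g t) s (D + E).
Proof.
move=> fD gE e e0; near=> t.
have : f t <= f s + (D + e / 2) * (t - s).
  by near: t; apply: fD; rewrite divr_gt0.
have : g t <= g s + (E + e / 2) * (t - s).
  by near: t; apply: gE; rewrite divr_gt0.
lra.
Unshelve. all: by end_near. Qed.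

Lemma right_slope_leZ (R : realType) (f : R -> R) (s c D : R) : 0 <= c ->
  right_slope_le f s D -> right_slope_le (fun t => c * f t) s (c * D).
Proof.
move=> c0 fD e e0; near=> t.
have st : s < t by near: t; exact: nbhs_right_gt.
have : f t <= f s + (D + e / (c + 1)) * (t - s).
  by near: t; apply: fD; rewrite divr_gt0// ltr_wpDl.
move=> /(ler_wpM2l c0) /le_trans; apply.
have ts : 0 <= t - s by rewrite subr_ge0 ltW.
rewrite mulrDr lerD2l mulrA ler_wpM2r// mulrDr lerD2l.
by rewrite mulrCA ler_piMr ?ltW// ltr_pdivrMr ?mul1r ?ltrDl// ltr_wpDl.
Unshelve. all: by end_near. Qed.

Lemma right_slope_le_sum (R : realType) (I : eqType) (A : seq I) (f : I -> R -> R)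
    (D : I -> R) (s : R) :
  (forall i, i \in A -> right_slope_le (f i) s (D i)) ->
  right_slope_le (fun t => \sum_(i <- A) f i t) s (\sum_(i <- A) D i).
Proof.
elim: A => [_ e e0|i A IH fD].
  near=> t; rewrite !big_nil !add0r mulr_ge0 ?ltW// subr_gt0.
  by near: t; exact: nbhs_right_gt.
rewrite big_cons; under eq_fun do rewrite big_cons.
apply: right_slope_leD; first by apply: fD; rewrite mem_head.
by apply: IH => j jA; apply: fD; rewrite inE jA orbT.
Unshelve. all: by end_near. Qed.

(** At a zero of [w] the positive part follows [w] exactly when [w] is increasing,
which decides the value of the indicator there. *)
Lemma right_slope_le_max0 (R : realType) (w : R -> R) (s D : R) :
  w t @[t --> s^'+] --> w s ->
  right_slope_le w s D ->
  right_slope_le (fun t => Num.max 0 (w t)) s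
    (if (0 < w s) || (w s == 0) && (0 < D) then D else 0).
Proof.
move=> ws wD e e0; have [ws0|ws0|ws0] /= := ltrgtP (w s) 0.
- near=> t.
  have st : s < t by near: t; exact: nbhs_right_gt.
  have : w t < 0 by near: t; exact: cvgr_lt ws _ ws0.
  by move=> /ltW/max_l ->; rewrite add0r add0r mulr_ge0 ?ltW// subr_gt0.
- near=> t.
  have : 0 < w t by near: t; exact: cvgr_gt ws _ ws0.
  by move=> /ltW/max_r ->; near: t; exact: wD.
- near=> t.
  have st : s < t by near: t; exact: nbhs_right_gt.
  have wt : w t <= w s + (D + e) * (t - s) by near: t; exact: wD.
  rewrite ws0 add0r in wt; rewrite ws0 add0r ge_max.
  have et : 0 <= e * (t - s) by rewrite mulr_ge0 ?ltW// subr_gt0.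
  have [D0|D0] := ltP 0 D.
    rewrite wt andbT mulr_ge0 ?subr_ge0 1?ltW//.
    by rewrite addr_gt0.
  by rewrite add0r et (le_trans wt)// ler_wpM2r ?gerDr// subr_ge0 ltW.
Unshelve. all: by end_near. Qed.

(** If [f] exceeded the bound at [b], tilting it by a slope slightly above [C]
would still leave it above an intermediate level [L] at [b] and below [L] near
[a].  At the last time where the tilted function is at most [L] it has negative
upper right slope, although it is larger than [L] right afterwards. *)
Lemma right_slope_le_growth (R : realType) (f : R -> R) (a b C : R) :
  a < b -> f t @[t --> a^'+] --> f a ->
  (forall s, a < s <= b -> f t @[t --> s] --> f s) ->
  (forall s, a < s < b -> right_slope_le f s C) ->
  f b <= f a + C * (b - a).
Proof.
move=> ab fa fc fC; apply/ler_addgt0Pr => e e0.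
rewrite leNgt; apply/negP => fb.
pose d := e / 2 / (b - a).
have ba : 0 < b - a by rewrite subr_gt0.
have d0 : 0 < d by rewrite !divr_gt0.
pose g t := f t - (C + d) * t.
pose L := f a - (C + d) * a + e / 4.
have gb : L < g b.
  have : d * (b - a) = e / 2 by rewrite /d mulfVK// gt_eqF.
  by rewrite /L /g; lra.
have gc s : a < s <= b -> g t @[t --> s] --> g s.
  move=> sab; apply: cvgB; first exact: fc.
  by apply: cvgM; [exact: cvg_cst|exact: cvg_id].
have ga : g t @[t --> a^'+] --> g a.
  apply: cvgB => //; apply: cvgM; first exact: cvg_cst.
  by apply: cvg_at_right_filter; exact: cvg_id.
pose S := [set t | a < t <= b /\ g t <= L].
(* The margin [e / 4] makes the last time at level [L] differ from [a]. *)
have [t0 [at0 t0b gt0]] : exists t, [/\ a < t, t <= b & g t <= L].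
  near a^'+ => t; exists t; split.
  - by near: t; exact: nbhs_right_gt.
  - by near: t; exact: nbhs_right_le.
  - near: t; apply: cvgr_le ga _ _; rewrite /L /g ltrDl; exact: divr_gt0.
have S0 : S t0 by rewrite /S/= at0 t0b.
have supS : has_sup S by split; [exists t0|exists b => t [/andP[_]]].
have aS : a < sup S by rewrite (lt_le_trans at0)// ub_le_sup//; case: supS.
have Sb : sup S <= b by apply: ge_sup; [exists t0|move=> t [/andP[_]]].
have gS : g (sup S) <= L.
  rewrite leNgt; apply/negP => Lg.
  have : \forall t \near sup S, L < g t.
    by apply: cvgr_gt (gc _ _) _ Lg; rewrite aS.
  move=> /nbhs_ballP[k /= k0 kS].
  have [t St /= tS] := sup_adherent k0 supS.
  have /kS : ball (sup S) k t.
    rewrite /ball/= ger0_norm ?subr_ge0; last by rewrite ub_le_sup//; case: supS.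
    by rewrite ltrBlDl -ltrBlDr.
  by rewrite ltNge; case: St => _ ->.
have {}Sb : sup S < b.
  by rewrite lt_neqAle Sb andbT; apply: contraTneq gb => <-; rewrite -leNgt.
near (sup S)^'+ => t.
have St : sup S < t by near: t; exact: nbhs_right_gt.
have tb : t <= b by near: t; exact: nbhs_right_le.
have : f t <= f (sup S) + (C + d) * (t - sup S).
  by near: t; apply: fC => //; rewrite aS.
have : L < g t.
  rewrite ltNge; apply/negP => gt.
  have : t <= sup S.
    by apply: ub_le_sup; [case: supS|split=> //; rewrite tb (lt_trans aS)].
  by rewrite leNgt St.
by move: gS; rewrite /g; lra.
Unshelve. all: by end_near. Qed.

(** * The p-Laplacian on finite sets of vertices *)

Lemma uniq_subset_sum_le (R : realType) (I : choiceType) (A S : seq I)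
    (F : I -> R) : uniq A -> uniq S -> {subset A <= S} ->
  (forall i, 0 <= F i) -> \sum_(i <- A) F i <= \sum_(i <- S) F i.
Proof.
move=> uA uS AS F0.
have AE : perm_eq [seq i <- S | i \in A] A.
  apply: uniq_perm; rewrite ?filter_uniq// => i.
  by rewrite mem_filter; case: (boolP (i \in A)) => // /AS ->.
rewrite -(perm_big _ AE)/= big_filter big_mkcond/=.
by apply: ler_sum => i _; case: ifP.
Qed.

Local Notation adj := (Defs.adjacent (@weight _ _)).

Definition neighbours (R : realType) (G : weighted_graph R) (x : G) : seq G :=
  finmap.enum_fset (fset_set [set y | adj x y]).

Section weighted_graph.
Context (R : realType) (G : weighted_graph R).
Implicit Types (x y o : G) (A : seq G) (a b f phi : G -> R).

Lemma mem_neighbours x y : (y \in neighbours x) = adj x y.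
Proof.
rewrite -[LHS]/(y \in fset_set [set y | adj x y]).
by rewrite in_fset_set; [exact: asboolb|exact: locally_finite].
Qed.

Lemma not_adjacent_weight x y :
  ~~ adj x y -> weight x y = 0.
Proof.
by rewrite /Defs.adjacent -leNgt => w0; apply/eqP; rewrite eq_le w0 weight_ge0.
Qed.

Lemma weight_sum_le_mu x A : uniq A -> \sum_(y <- A) weight x y <= mu x.
Proof.
move=> uA; pose S := undup (A ++ neighbours x).
have -> : mu x = \sum_(y <- S) weight x y.
  rewrite /mu /degree_measure (fsbig_widen _ setT)//.
    rewrite (@fsbigE _ _ _ _ _ S) ?undup_uniq//=.
      by apply: eq_bigl => y; rewrite in_setT.
    move=> y _.
    rewrite mem_undup mem_cat mem_neighbours negb_or => /andP[_].
    exact: not_adjacent_weight.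
  by move=> y [_ /= /negP]; exact: not_adjacent_weight.
apply: uniq_subset_sum_le; rewrite ?undup_uniq//; last exact: weight_ge0.
by move=> y yA; rewrite mem_undup mem_cat yA.
Qed.

Lemma inf_mu_le x : inf (range (@mu R G)) <= mu x.
Proof.
apply: ge_inf; last by exists x.
exists 0 => _ [y _ <-]; have := @weight_sum_le_mu y [::] isT.
by rewrite big_nil.
Qed.

Lemma mu_gt0 x : 0 < mu x.
Proof. exact: lt_le_trans (degree_measure_inf_gt0 G) (inf_mu_le x). Qed.

Lemma p_laplacianE p f x A : uniq A ->
    (forall y, adj x y -> y \in A) ->
  mu x * p_laplacian p f x =
  \sum_(y <- A) signed_pow (f y - f x) (p - 1) * weight x y.
Proof.
move=> uA xA; rewrite /p_laplacian mulrA mulfV ?gt_eqF ?mu_gt0// mul1r.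
rewrite (@fsbigE _ _ _ _ _ A)//=.
  apply: eq_big => [y|y _]; first by rewrite in_setT.
  rewrite /signed_pow.
  by congr (_ `^ _ * _ * _); lra.
move=> y _ yA; rewrite not_adjacent_weight ?mulr0//.
by apply: contra yA; exact: xA.
Qed.

(** The indicator [sg] is only constrained to be compatible with the order of [a]
and [b], so its value is free where they agree. *)
Lemma cutoff_flux_le p phi a b (sg : pred G) A : 1 < p -> uniq A ->
    (forall x, 0 <= phi x) ->
    (forall x y, adj x y -> `|phi x - phi y| <= 1) ->
    (forall x y, phi x != 0 -> adj x y -> y \in A) ->
    (forall x, sg x -> b x <= a x) -> (forall x, ~~ sg x -> a x <= b x) ->
  \sum_(x <- A) phi x * mu x *
     (if sg x then p_laplacian p a x - p_laplacian p b x else 0) <=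
  2 `^ (p - 1) *
  \sum_(x <- A) (`|a x| `^ (p - 1) + `|b x| `^ (p - 1)) * mu x.
Proof.
move=> p1 uA phi0 phi1 phiA ab ba; have p0 : 0 < p - 1 by rewrite subr_gt0.
pose H x y := signed_pow (a y - a x) (p - 1) - signed_pow (b y - b x) (p - 1).
pose h x := `|a x| `^ (p - 1) + `|b x| `^ (p - 1).
have HN x y : H y x = - H x y.
  by rewrite /H -(opprB (a y)) -(opprB (b y)) !signed_powN; lra.
have Hh x y : `|H x y| <= 2 `^ (p - 1) * (h x + h y).
  rewrite (le_trans (ler_normB _ _))// !normr_signed_pow//.
  have := normr_subr_powR_le (a y) (a x) (ltW p0).
  have := normr_subr_powR_le (b y) (b x) (ltW p0).
  rewrite /h; lra.
have H0 x y : sg x -> ~~ sg y -> H x y <= 0.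
  move=> /ab bax /ba aby; rewrite subr_le0 signed_pow_le//; lra.
pose c x y := phi x * (sg x)%:R * (weight x y * H x y).
have -> : \sum_(x <- A) phi x * mu x *
    (if sg x then p_laplacian p a x - p_laplacian p b x else 0) =
    \sum_(x <- A) \sum_(y <- A) c x y.
  apply: eq_bigr => x _; rewrite /c -mulr_sumr -!mulrA.
  have [->|phix] := eqVneq (phi x) 0; first by rewrite !mul0r.
  congr (_ * _); case: ifP => _; last by rewrite mulr0 mul0r.
  rewrite mul1r mulrBr !(@p_laplacianE _ _ _ A) -?sumrB//.
  - by apply: eq_bigr => y _; rewrite /H; ring.
  - by move=> y; exact: phiA.
  - by move=> y; exact: phiA.
(* The flux [H] is antisymmetric, hence the left side is half the sum of the
   terms [c x y + c y x], each of which is estimated on its own edge. *)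
have symm : (\sum_(x <- A) \sum_(y <- A) c x y) *+ 2 =
    \sum_(x <- A) \sum_(y <- A) (c x y + c y x).
  rewrite mulr2n [X in X + _ = _]exchange_big/= -big_split/=.
  by apply: eq_bigr => x _; rewrite -big_split/=; apply: eq_bigr => y _; rewrite addrC.
have cc x y : c x y + c y x <=
    2 `^ (p - 1) * (weight x y * h x) + 2 `^ (p - 1) * (weight y x * h y).
  rewrite /c (HN x y) (weight_sym y x).
  have [xy|/not_adjacent_weight ->] := boolP (adj x y); last first.
    by rewrite !mul0r !mulr0 addr0.
  apply: (@le_trans _ _ (weight x y * `|H x y|)); last first.
    have := ler_wpM2l (weight_ge0 x y) (Hh x y); lra.
  rewrite [leLHS](_ : _ = weight x y *
    ((phi x * (sg x)%:R - phi y * (sg y)%:R) * H x y)); last by ring.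
  rewrite ler_wpM2l ?weight_ge0//.
  (* Inside [sg] only the variation of [phi] is left; across the boundary of
     [sg] the flux has the good sign. *)
  case: (boolP (sg x)) => sx; case: (boolP (sg y)) => sy.
  - rewrite !mulr1 (le_trans (ler_norm _))// normrM.
    by rewrite ler_piMl// phi1.
  - rewrite mulr1 mulr0 subr0 (le_trans _ (normr_ge0 _))//.
    by rewrite mulr_ge0_le0// H0.
  - rewrite mulr1 mulr0 sub0r mulNr -mulrN -(HN x y) (le_trans _ (normr_ge0 _))//.
    by rewrite mulr_ge0_le0// H0.
  - by rewrite !mulr0 subr0 mul0r.
suff : (\sum_(x <- A) \sum_(y <- A) c x y) *+ 2 <=
    (2 `^ (p - 1) * \sum_(x <- A) h x * mu x) *+ 2 by rewrite ler_pMn2r.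
rewrite symm.
apply: (@le_trans _ _ (\sum_(x <- A) \sum_(y <- A)
  (2 `^ (p - 1) * (weight x y * h x) + 2 `^ (p - 1) * (weight y x * h y)))).
  by apply: ler_sum => x _; apply: ler_sum => y _.
rewrite [leLHS](_ : _ =
  (\sum_(x <- A) \sum_(y <- A) 2 `^ (p - 1) * (weight x y * h x)) *+ 2).
  rewrite lerMn2r/= mulr_sumr; apply: ler_sum => x _.
  rewrite -mulr_sumr ler_wpM2l ?powR_ge0// -mulr_suml mulrC ler_wpM2l//.
    by rewrite addr_ge0 ?powR_ge0.
  exact: weight_sum_le_mu.
rewrite mulr2n [X in _ = _ + X]exchange_big/= -big_split/=.
by apply: eq_bigr => x _; rewrite -big_split.
Qed.

End weighted_graph.

(** * Tents around a vertex *)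

Section exhaustion.
Context (R : realType) (G : weighted_graph R).
Implicit Types (x y o : G).

Fixpoint hop_ball o n : seq G :=
  if n is m.+1 then
    undup (hop_ball o m ++ flatten [seq neighbours x | x <- hop_ball o m])
  else [:: o].

Lemma hop_ball_uniq o n : uniq (hop_ball o n).
Proof. by case: n => //= n; exact: undup_uniq. Qed.

Lemma hop_ball_mono o m n : (m <= n)%N -> {subset hop_ball o m <= hop_ball o n}.
Proof.
move=> /subnK <-; elim: (n - m)%N => // k IH x /IH xk.
by rewrite addSn /= mem_undup mem_cat xk.
Qed.

Lemma hop_ball_adj o n x y : adj x y ->
  x \in hop_ball o n -> y \in hop_ball o n.+1.
Proof.
move=> xy xn /=; rewrite mem_undup mem_cat; apply/orP; right.
by apply/flatten_mapP; exists x => //; rewrite mem_neighbours.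
Qed.

(** Counting the balls of radius less than [N] that contain [x] gives the positive
part of [N - d(o, x)] without defining the graph distance. *)
Definition tent o N x : R := (\sum_(n < N) (x \in hop_ball o n))%N%:R.

Lemma tent_ge0 o N x : 0 <= tent o N x.
Proof. exact: ler0n. Qed.

Lemma tent_center o N : tent o N o = N%:R.
Proof.
rewrite /tent (eq_bigr (fun=> 1%N)) ?sum1_card ?card_ord// => n _.
by rewrite (hop_ball_mono (leq0n n)) ?mem_head.
Qed.

Lemma tent_support o N x y : tent o N x != 0 -> adj x y -> y \in hop_ball o N.
Proof.
rewrite pnatr_eq0 sum_nat_eq0 negb_forall => /existsP[n].
rewrite implyTb eqb0 negbK => xn xy.
exact: hop_ball_mono (hop_ball_adj xy xn).
Qed.

(** If a ball around [o] contains [x], the next one contains [y]; shifting the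
radius by one adds at most the ball of radius [N] to the count. *)
Lemma tent_adj_le o N x y : adj x y -> tent o N x <= tent o N y + 1.
Proof.
move=> xy; rewrite /tent natr1 ler_nat.
apply: (@leq_trans (\sum_(n < N) (y \in hop_ball o n.+1))).
  apply: leq_sum => n _; case: (boolP (x \in _)) => // xn.
  by rewrite (hop_ball_adj xy xn).
rewrite -[X in (_ <= X)%N]addn1.
apply: (@leq_trans (\sum_(n < N.+1) (y \in hop_ball o n))).
  by rewrite big_ord_recl leq_addl.
by rewrite big_ord_recr leq_add2l leq_b1.
Qed.

Lemma tent_lipschitz o N x y : adj x y -> `|tent o N x - tent o N y| <= 1.
Proof.
move=> xy; rewrite ler_norml.
have yx : adj y x by rewrite /Defs.adjacent weight_sym.
by have := tent_adj_le o N xy; have := tent_adj_le o N yx; lra.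
Qed.

End exhaustion.

(** * Regularity in time *)

Lemma cvg_norm_powR (R : realType) (T : Type) (F : set_system T) {FF : Filter F}
    (f : T -> R) (l r : R) : 0 < r ->
  f t @[t --> F] --> l -> `|f t| `^ r @[t --> F] --> `|l| `^ r.
Proof.
move=> r0 fl; have [l0|l0] := eqVneq l 0.
  rewrite l0 in fl *; rewrite normr0 powR0 ?gt_eqF//.
  apply/cvgrPdist_lt => e e0.
  have er : 0 < e `^ r^-1 by exact: powR_gt0.
  near=> t; rewrite sub0r normrN ger0_norm ?powR_ge0//.
  rewrite -[ltRHS](powRr1 (ltW e0)) -(mulVf (lt0r_neq0 r0)) powRrM.
  rewrite gt0_ltr_powR ?nnegrE ?powR_ge0//.
  by rewrite -normrN -sub0r; near: t; move/cvgrPdist_lt: fl; exact.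
have : {for `|l|, continuous (fun a : R => a `^ r)}.
  apply/differentiable_continuous/derivable1_diffP/derivable_powR.
  by rewrite in_itv/= andbT normr_gt0.
by move=> rc; apply: (continuous_cvg _ rc); exact: cvg_norm.
Unshelve. all: by end_near. Qed.

Lemma derivable_right_slope_le (R : realType) (f : R -> R) (t : R) :
  derivable f t 1 -> right_slope_le f t (f^`() t)%classic.
Proof.
move=> df e e0.
have : (h^-1 *: (f (h + t) - f t)) @[h --> 0^'] --> (f^`() t)%classic.
  rewrite derive1E; move: df; rewrite /derivable /derive.
  by under eq_fun do rewrite [_%:A]mulr1.
move=> /cvg_dnbhs_at_right /cvgr_lt /(_ ((f^`() t)%classic + e)).
rewrite ltrDl => /(_ e0) /nbhs_ballP[d /= d0 dH].
exists d => //= s /= ts st.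
have s0 : 0 < s - t by rewrite subr_gt0.
have := dH (s - t); rewrite /ball/= sub0r normrN distrC.
move=> /(_ ts s0); rewrite subrK => /ltW.
by rewrite /GRing.scale/= mulrC ler_pdivrMr// lerBlDl.
Qed.

Section time_regularity.
Context (R : realType) (T : \bar R).

Lemma time_interval_right (t : R) : time_interval T t ->
  \forall s \near t^'+, time_interval T s.
Proof.
move=> [t0 tT]; have sT : \forall s \near t^'+, (s%:E < T)%E.
  case: T tT => [T'| |//]; last by move=> _; apply: nearW => s; rewrite ltry.
  by rewrite lte_fin => /nbhs_right_lt; apply: filterS => s; rewrite lte_fin.
near=> s; split; last by near: s.
by apply: (le_trans t0); near: s; exact: nbhs_right_ge.
Unshelve. all: by end_near. Qed.

Lemma time_interval_nbhs (t : R) : 0 < t -> (t%:E < T)%E ->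
  \forall s \near t, time_interval T s.
Proof.
move=> t0 tT; have sT : \forall s \near t, (s%:E < T)%E.
  case: T tT => [T'| |//]; last by move=> _; near=> s; rewrite ltry.
  by rewrite lte_fin => /lt_nbhsl; apply: filterS => s; rewrite lte_fin.
near=> s; split; last by near: s.
by apply: ltW; near: s; exact: lt_nbhsr.
Unshelve. all: by end_near. Qed.

(** At an interior time the restriction to the interval disappears, so one gets a
genuine two-sided derivative. *)
Lemma C1_on_derivable (f : R -> R) (t : R) : C1_on (time_interval T) f ->
  0 < t -> (t%:E < T)%E -> derivable f t 1.
Proof.
move=> [g _ fg] t0 tT.
have tI : time_interval T t by split=> //; exact: ltW.
have tN := time_interval_nbhs t0 tT.
apply/cvg_ex; exists (g t); apply/cvgrPdist_lt => e e0.
have /cvgrPdist_lt/(_ e e0) := fg t tI.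
rewrite !near_withinE => /(filterI tN) /nbhs_ballP[d /= d0 dH].
apply/nbhs_ballP; exists d => //= h; rewrite /ball/= sub0r normrN => hd h0.
have [] := dH (h + t).
  by rewrite /ball/= opprD addrCA subrr addr0 normrN.
move=> hI /(_ _ hI); rewrite [h%:A]mulr1 addrK /GRing.scale/= mulrC; apply.
by rewrite -subr_eq0 addrK.
Qed.

(** This serves at the time 0, where only the one-sided difference quotient is
available. *)
Lemma C1_on_right_continuous (f : R -> R) (t : R) :
  C1_on (time_interval T) f -> time_interval T t ->
  f s @[s --> t^'+] --> f t.
Proof.
move=> [g _ fg] tI.
have q : (f s - f t) / (s - t) @[s --> t^'+] --> g t.
  apply: cvg_trans (fg t tI) => A /=; rewrite /nbhs/= => tA.
  have {}tA : \forall s \near t, s != t -> time_interval T s ->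
    A ((f s - f t) / (s - t)) by exact: tA.
  have At : \forall s \near t^'+, s != t -> time_interval T s ->
    A ((f s - f t) / (s - t)) by apply: cvg_within tA.
  near=> s; have st : s != t by rewrite gt_eqF//; near: s; exact: nbhs_right_gt.
  have : time_interval T s by near: s; exact: time_interval_right.
  by move: st; near: s.
have : f t + (f s - f t) / (s - t) * (s - t) @[s --> t^'+] --> f t + g t * (t - t).
  apply: cvgD; first exact: cvg_cst.
  apply: cvgM => //; apply: cvgB; last exact: cvg_cst.
  by apply: cvg_at_right_filter; exact: cvg_id.
rewrite subrr mulr0 addr0; apply: cvg_trans; apply: near_eq_cvg.
near=> s; have st : t < s by near: s; exact: nbhs_right_gt.
by rewrite divfK ?subrKC// subr_eq0 gt_eqF.
Unshelve. all: by end_near. Qed.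

End time_regularity.

(** * Bounds on solutions and comparison *)

Section solutions.
Context (R : realType) (G : weighted_graph R).
Implicit Types (x y o : G) (A : seq G) (r s t : R).

Lemma lr_norm_sum_le r (f : G -> R) (M : R) A : 0 < r -> 0 <= M ->
  (lr_norm r f <= M%:E)%E -> uniq A ->
  \sum_(x <- A) `|f x| `^ r * mu x <= M `^ r.
Proof.
move=> r0 M0 fM uA; rewrite -lee_fin -poweR_EFin.
have F0 x : (0 <= (`|f x| `^ r * mu x)%:E)%E.
  by rewrite lee_fin mulr_ge0 ?powR_ge0// ltW// mu_gt0.
apply: (@le_trans _ _ (\esum_(x in [set: G]) (`|f x| `^ r * mu x)%:E)%E).
  apply: esum_ge; exists [set` A]; first by split=> //; exact: finite_seq.
  by rewrite -fsbig_seq// sumEFin.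
have E0 : (0 <= \esum_(x in [set: G]) (`|f x| `^ r * mu x)%:E)%E.
  by apply: esum_ge0.
rewrite -[leLHS](poweRe1 E0) -(mulVf (lt0r_neq0 r0)) poweRrM.
apply: gt0_ler_poweR fM; first exact: ltW.
- by rewrite in_itv/= poweR_ge0 leey.
- by rewrite in_itv/= lee_fin M0 leey.
Qed.

(** A finite partial sum that exceeded the essential bound at one time would, by
continuity, exceed it on a whole interval, which has positive measure. *)
Lemma Linfty_lr_sum_le (T : \bar R) r (u : G -> R -> R) : 0 < r ->
    in_Linfty_lr T r u ->
    (forall x t, 0 < t -> (t%:E < T)%E -> u x s @[s --> t] --> u x t) ->
  exists M, forall A t, uniq A -> 0 < t -> (t%:E < T)%E ->
    \sum_(x <- A) `|u x t| `^ r * mu x <= M.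
Proof.
move=> r0 uoo uc; have [M M0 uM] : exists2 M : R, 0 <= M &
    {ae lebesgue_measure, forall t : R,
      ((fun t => lr_norm r (u ^~ t)) \_ (time_interval T) t <= M%:E)%E}.
  move: uoo; rewrite /in_Linfty_lr; set S := ess_sup _ _ => Soo.
  exists (Num.max 0 (fine S)); first by rewrite le_max lexx.
  apply/ess_supP; rewrite -/S; case: S Soo => [s| |]//= _.
    by rewrite lee_fin le_max lexx orbT.
  exact: leNye.
exists (M `^ r) => A t uA t0 tT; rewrite leNgt; apply/negP => Mt.
have St : \sum_(x <- A) `|u x s| `^ r * mu x @[s --> t] -->
    \sum_(x <- A) `|u x t| `^ r * mu x.
  apply: cvg_big => [|x _]; first exact: add_continuous.
  by apply: cvgM; [exact: cvg_norm_powR (uc _ _ t0 tT)|exact: cvg_cst].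
have bad : \forall s \near t, time_interval T s /\
    M `^ r < \sum_(x <- A) `|u x s| `^ r * mu x.
  apply: filterI; first exact: time_interval_nbhs.
  exact: cvgr_gt St _ Mt.
have /nbhs_ballP[d /= d0 dbad] := bad.
case: uM => N [mN N0 subN].
pose B : set R := `]t - d, t + d[%classic.
have dN : B `<=` N.
  rewrite /B -ball_itv => s /dbad[sI sM]; apply: subN => /=.
  rewrite patchE mem_set// => us.
  by move: sM; rewrite ltNge (lr_norm_sum_le r0 M0 us uA).
have : (lebesgue_measure B <= lebesgue_measure N)%E.
  by rewrite le_measure//; apply: mem_set => //; exact: measurable_itv.
rewrite N0 /B lebesgue_measure_itv/= lte_fin ifT; last lra.
by rewrite -EFinD lee_fin; lra.
Qed.

Context (p q r : R) (T : \bar R).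
Context (p1 : 1 < p) (q0 : 0 < q) (r1 : 1 <= r) (rqp : r <= q * (p - 1)).

Let r0 : 0 < r. Proof. exact: lt_le_trans r1. Qed.

Section one_solution.
Context (u0 : G -> R) (u : G -> R -> R) (usol : is_solution p q r T u0 u).

Lemma solution_derivable x t : 0 < t -> (t%:E < T)%E -> derivable (u x) t 1.
Proof. by move=> ? ?; apply: C1_on_derivable (solution_C1 usol x) _ _. Qed.

Lemma solution_continuous x t : 0 < t -> (t%:E < T)%E ->
  u x s @[s --> t] --> u x t.
Proof.
move=> t0 tT.
exact/differentiable_continuous/derivable1_diffP/solution_derivable.
Qed.

(** Here the assumption [r <= q * (p - 1)] enters: a single term of the l^r sum
bounds [|u x t|], because [mu] stays away from 0, and the higher power is then
dominated by the r-th one. *)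
Lemma solution_flux_sum_le : exists K, forall A t, uniq A -> 0 < t ->
  (t%:E < T)%E ->
  \sum_(x <- A) `|signed_pow (u x t) q| `^ (p - 1) * mu x <= K.
Proof.
have [M uM] := Linfty_lr_sum_le r0 (solution_Linfty usol) solution_continuous.
pose m := inf (range (@mu R G)).
have m0 : 0 < m := degree_measure_inf_gt0 G.
pose c := (M / m) `^ (q * (p - 1) / r - 1).
exists (c * M) => A t uA t0 tT.
apply: (le_trans _ (ler_wpM2l (powR_ge0 _ _) (uM A t uA t0 tT))).
rewrite mulr_sumr; apply: ler_sum => x _.
rewrite normr_signed_pow// -powRrM mulrA ler_wpM2r ?(ltW (mu_gt0 x))//.
apply: bounded_powR_le => //.
have := uM [:: x] t isT t0 tT; rewrite big_seq1 ler_pdivlMr//.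
by apply: le_trans; rewrite ler_wpM2l ?powR_ge0// inf_mu_le.
Qed.

End one_solution.

Lemma solution_comparison (u0 v0 : G -> R) (u v : G -> R -> R) :
  is_solution p q r T u0 u -> is_solution p q r T v0 v ->
  (forall x, u x 0 <= v x 0) ->
  forall x t, 0 <= t -> (t%:E < T)%E -> u x t <= v x t.
Proof.
move=> usol vsol uv0 o t; rewrite le_eqVlt => /predU1P[<- //|t0 tT].
have sT s : s <= t -> (s%:E < T)%E by move=> st; rewrite (le_lt_trans _ tT)// lee_fin.
have [Ku uK] := solution_flux_sum_le usol.
have [Kv vK] := solution_flux_sum_le vsol.
pose C := 2 `^ (p - 1) * (Ku + Kv).
pose w x s := u x s - v x s.
pose f N s := \sum_(x <- hop_ball o N) tent o N x * mu x * Num.max 0 (w x s).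
have wc x s : 0 < s -> s <= t -> w x z @[z --> s] --> w x s.
  move=> s0 /sT sT'.
  by apply: cvgB; [exact: (solution_continuous usol)|exact: (solution_continuous vsol)].
have w0 x : w x z @[z --> 0^'+] --> w x 0.
  have I0 : time_interval T 0 by split=> //; exact: sT (ltW t0).
  by apply: cvgB; [exact: C1_on_right_continuous (solution_C1 usol x) I0
                  |exact: C1_on_right_continuous (solution_C1 vsol x) I0].
have fc N s (F : set_system R) : Filter F ->
    (forall x, w x z @[z --> F] --> w x s) -> f N z @[z --> F] --> f N s.
  move=> FF wF; apply: cvg_big => [|x _]; first exact: add_continuous.
  apply: cvgM; first exact: cvg_cst.
  have maxc : {for w x s, continuous (fun z : R => Num.max 0 z)}.
    by apply: (@continuous_max R R (cst 0) id); [exact: cvg_cst|exact: cvg_id].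
  by apply: (continuous_cvg _ maxc); exact: wF.
have fslope N s : 0 < s < t -> right_slope_le (f N) s C.
  move=> /andP[s0 st]; have {}sT := sT _ (ltW st).
  pose a x := signed_pow (u x s) q; pose b x := signed_pow (v x s) q.
  pose D x := p_laplacian p a x - p_laplacian p b x.
  pose sg x := (0 < w x s) || (w x s == 0) && (0 < D x).
  apply: (@right_slope_le_weaken _ _ _ (\sum_(x <- hop_ball o N)
      tent o N x * mu x * (if sg x then D x else 0))).
    apply: (le_trans (cutoff_flux_le p1 (hop_ball_uniq o N) (@tent_ge0 _ _ o N)
      (@tent_lipschitz _ _ o N) (@tent_support _ _ o N) _ _)).
    - move=> x /orP[|/andP[/eqP + _]]; rewrite /w => ws.
        by apply: signed_pow_le => //; lra.
      by apply: signed_pow_le => //; lra.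
    - move=> x; rewrite /sg negb_or -leNgt => /andP[ws _].
      by apply: signed_pow_le => //; move: ws; rewrite /w; lra.
    - rewrite ler_wpM2l ?powR_ge0//.
      under eq_bigr do rewrite mulrDl.
      by rewrite big_split lerD ?uK ?vK ?hop_ball_uniq.
  apply: right_slope_le_sum => x _; apply: right_slope_leZ.
    by rewrite mulr_ge0 ?tent_ge0// ltW// mu_gt0.
  apply: right_slope_le_max0.
    by apply: cvg_at_right_filter; apply: wc => //; exact: ltW.
  have du := @solution_derivable _ _ usol x _ s0 sT.
  have dv := @solution_derivable _ _ vsol x _ s0 sT.
  have -> : D x = ((w x)^`() s)%classic.
    rewrite derive1E deriveB// -!derive1E.
    by rewrite (solution_eq usol) ?(solution_eq vsol).
  by apply: derivable_right_slope_le; exact: derivableB.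
(* Only the term of the center is kept on the left, where the tent has its
   full height [N]; the growth rate [C] does not depend on [N]. *)
have fN N : N%:R * (mu o * w o t) <= C * t.
  apply: (@le_trans _ _ (f N t)).
    have oN : o \in hop_ball o N by rewrite (hop_ball_mono (leq0n N)) ?mem_head.
    rewrite /f (big_rem o)//= tent_center -mulrA -[leLHS]addr0 lerD//.
      by rewrite !ler_wpM2l ?le_max ?lexx ?orbT// ltW// mu_gt0.
    apply: sumr_ge0 => x _; rewrite mulr_ge0 ?le_max ?lexx//.
    by rewrite mulr_ge0 ?tent_ge0// ltW// mu_gt0.
  have : f N t <= f N 0 + C * (t - 0).
    apply: right_slope_le_growth => //.
    - exact: fc.
    - move=> s /andP[s0 st]; apply: fc => x; exact: wc.
    - exact: fslope.
  rewrite subr0 [f N 0]big1 ?add0r// => x _.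
  by rewrite max_l ?mulr0// subr_le0.
rewrite leNgt; apply/negP => vu.
have mw : 0 < mu o * w o t by rewrite mulr_gt0 ?mu_gt0// subr_gt0.
have [N CN] : exists N, C * t / (mu o * w o t) < N%:R.
  by exists (Num.truncn (C * t / (mu o * w o t))).+1; exact: truncnS_gt.
by have := fN N; rewrite leNgt -ltr_pdivrMr// CN.
Qed.

End solutions.

Unset Implicit Arguments.

Theorem theorem1p4 (R : realType) (G : weighted_graph R) (p q r : R)
    (T : \bar R) (hp : 1 < p) (hq : 0 < q) (hr : 1 <= r)
    (hqr : r <= q * (p - 1)) (hT : (0 < T)%E) :
  (forall (u0 v0 : G -> R) (u v : G -> R -> R),
     is_solution p q r T u0 u -> is_solution p q r T v0 v ->
     (forall x, u x 0 <= v x 0) ->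
     forall (x : G) (t : R), 0 <= t -> (t%:E < T)%E -> u x t <= v x t) /\
  (forall (u0 : G -> R), in_lr r u0 ->
     forall u v : G -> R -> R,
     is_solution p q r T u0 u -> is_solution p q r T u0 v ->
     forall (x : G) (t : R), 0 <= t -> (t%:E < T)%E -> u x t = v x t).
Proof.
have cmp := @solution_comparison R G p q r T hp hq hr hqr.
split; first exact: cmp.
move=> u0 _ u v usol vsol x t t0 tT; apply/eqP; rewrite eq_le.
have [eu ev] := (solution_init usol, solution_init vsol).
by rewrite (cmp _ _ _ _ usol vsol) ?(cmp _ _ _ _ vsol usol)// => y; rewrite eu ev.
Qed.
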